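(* Let $n$ and $k$ be integers with $1 \leq k < n/2$. (i) If $n$ is odd, then $\mathrm{GP}(n,k)$ is stable. (ii) $\mathrm{GP}(n,k)$ is trivially unstable if and only if $n$ is even and $k$ is odd. (iii) If both $n$ and $k$ are even, then $\mathrm{GP}(n,k)$ is nontrivially unstable if and only if $k^2\equiv\pm 1 \pmod{n/2}$ or $n=4k$.
   Context: For integers $n,k$ with $1\le k<n/2$, the generalized Petersen graph $\mathrm{GP}(n,k)$ is the graph with vertices $u_0,\dots,u_{n-1},v_0,\dots,v_{n-1}$ and edges $\{u_i,u_{i+1}\}$, $\{u_i,v_i\}$, $\{v_i,v_{i+k}\}$ for $i\in\{0,\dots,n-1\}$, subscripts taken modulo $n$. The canonical double cover $D(\Gamma)$ of a graph $\Gamma$ is the direct product $\Gamma\times K_2$: its vertex set is $V(\Gamma)\times\mathbb{Z}_2$, and $(u,x)$, $(v,y)$ are adjacent iff $u,v$ are adjacent in $\Gamma$ and $x\neq y$. One always has $\mathrm{Aut}(D(\Gamma))\geq \mathrm{Aut}(\Gamma)\times\mathbb{Z}_2$ (automorphisms of $\Gamma$ acting on the first coordinate, and the swap of the second coordinate). $\Gamma$ is called stable if $\mathrm{Aut}(D(\Gamma))=\mathrm{Aut}(\Gamma)\times\mathbb{Z}_2$, and unstable otherwise. A graph is vertex-determining if no two distinct vertices have the same neighbourhood. An unstable graph is nontrivially unstable if it is connected, non-bipartite and vertex-determining, and trivially unstable otherwise. *)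

(* Defs.v *)
(* finite graphs as symmetric relations on a finType. *)
From mathcomp Require Import all_boot all_fingroup.
Set Implicit Arguments. Unset Strict Implicit. Unset Printing Implicit Defensive.

Definition is_aut (T : finType) (e : rel T) (p : {perm T}) : Prop :=
  forall x y, e (p x) (p y) = e x y.

Section Graphs.
Variable T : finType.

Definition dcover (e : rel T) : rel (T * bool) :=
  fun a b => e a.1 b.1 && (a.2 != b.2).

(* Aut(D(G)) = Aut(G) x Z_2: every automorphism of D(G) is of the form
   (u, x) |-> (s u, x + c) with s in Aut(G), c in Z_2. The reverse inclusion
   always holds. *)
Definition stable (e : rel T) : Prop :=
  forall p : {perm (T * bool)}, is_aut (dcover e) p ->
    exists s : {perm T}, exists c : bool,
      is_aut e s /\ forall u x, p (u, x) = (s u, addb x c).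

Definition unstable (e : rel T) : Prop := ~ stable e.

Definition connected (e : rel T) : Prop := forall x y, connect e x y.

Definition bipartite (e : rel T) : Prop :=
  exists f : T -> bool, forall x y, e x y -> f x != f y.

Definition vertex_determining (e : rel T) : Prop :=
  forall x y, (forall z, e x z = e y z) -> x = y.

Definition nontrivially_unstable (e : rel T) : Prop :=
  unstable e /\ connected e /\ ~ bipartite e /\ vertex_determining e.

Definition trivially_unstable (e : rel T) : Prop :=
  unstable e /\ ~ (connected e /\ ~ bipartite e /\ vertex_determining e).

End Graphs.

(* Generalized Petersen graph GP(n,k): vertex (false, i) is u_i,
   vertex (true, i) is v_i; subscripts modulo n. *)
Definition gp_rel (n k : nat) : rel (bool * 'I_n) :=
  fun a b =>
    match a.1, b.1 with
    | false, false => ((a.2 + 1) %% n == b.2) || ((b.2 + 1) %% n == a.2)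
    | true, true => ((a.2 + k) %% n == b.2) || ((b.2 + k) %% n == a.2)
    | _, _ => a.2 == b.2
    end.
Arguments gp_rel : clear implicits.

(* Main.v *)
(* Idea. Let D be the double cover and tau its involution (v, c) |-> (v, c + 1).
   As GP(n, k) is connected, an automorphism p of D has the product form as soon
   as it commutes with tau.

   For each 2-arc of D count the closed non-backtracking 8-walks through it.
   The count depends only on whether the 2-arc is outer-outer, inner-inner or
   uses a spoke, and it is invariant under p.  So p preserves the spokes unless
   the three values agree; a spoke closing a walk gives a relation i + j k = 0
   mod n with |i| + |j| <= 8, and the agreement forces (n, k) = (5, 2) or (13, 5)
   for n odd, and one of the conditions of (iii) for n, k even.  For (13, 5)
   10-walks do the job; for (5, 2) tau w is the only vertex at distance 5 from w.

   If p preserves the spokes it maps rims to rims, as iterated unit steps.  For n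
   odd, tau is the n-th iterate of a rim step, so p commutes with it.  For n, k
   even, if some outer vertex goes to an inner one, the relation 2k = k + k
   between rim steps becomes 2k^2 = +-2 mod n; otherwise
   tau = spoke . inner step . spoke . (outer step)^(-+k) gives commutation,
   up to an ambiguity +-2k which is harmless unless 4k = n. *)

Require Import Defs.
From mathcomp Require Import all_boot all_fingroup.
From mathcomp Require Import all_order all_algebra zify ring.
Set Implicit Arguments. Unset Strict Implicit. Unset Printing Implicit Defensive.
Import GRing.Theory.

(** * Counting non-backtracking walks *)

Section NonBacktracking.
Variables (T : finType) (e : rel T).

(* Number of non-backtracking walks with [l] further edges whose first arc is
   [(a, b)] and whose last arc is [(x, y)]. *)
Fixpoint nbw (l : nat) (a b x y : T) : nat :=
  if l is l'.+1 then \sum_(c | e b c && (c != a)) nbw l' b c x y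
  else (a == x) && (b == y).

Lemma nbw_aut (p : {perm T}) l a b x y : is_aut e p ->
  nbw l (p a) (p b) (p x) (p y) = nbw l a b x y.
Proof.
move=> pA; elim: l a b => [|l IH] a b /=; first by rewrite !(inj_eq perm_inj).
rewrite (reindex_inj (@perm_inj _ p)) /=.
by apply: eq_big => [c|c _]; rewrite ?pA ?(inj_eq perm_inj) ?IH.
Qed.

End NonBacktracking.

(** * Walks as words in three steps *)

(* [None] follows a spoke, [Some true] and [Some false] move along a rim. *)
Definition step := option bool.
Definition inv_step : step -> step := omap negb.
Definition steps : seq step := [:: None; Some true; Some false].

Lemma inv_stepK : involutive inv_step.
Proof. by case=> [[]|]. Qed.

(* Non-backtracking continuations of a walk whose last step was [t]. *)
Fixpoint words (t : step) (l : nat) : seq (seq step) :=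
  if l is l'.+1 then
    flatten [seq [seq t' :: w | w <- words t' l'] | t' <- steps & t' != inv_step t]
  else [:: [::]].

Lemma wordsS t l : words t l.+1 =
  flatten [seq [seq t' :: w | w <- words t' l] | t' <- steps & t' != inv_step t].
Proof. by []. Qed.

Lemma size_words t l w : w \in words t l -> size w = l.
Proof.
elim: l t w => [|l IH] t w /=; first by rewrite inE => /eqP->.
by case/flattenP=> ? /mapP[t' _ ->] /mapP[w' /IH <- ->].
Qed.

(* A walk starting on the side [x] and displaced by [(i, j)] has moved [i + j k]
   along the indices. *)
Fixpoint displacement (x : bool) (w : seq step) : bool * (int * int) :=
  match w with
  | [::] => (x, (0%R, 0%R))
  | None :: w' => displacement (~~ x) w'
  | Some b :: w' =>
      let: (y, (i, j)) := displacement x w' in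
      let d : int := if b then 1%R else (-1)%R in
      (y, if x then (i, (d + j)%R) else ((d + i)%R, j))
  end.

(* [i + j k = 0] does not change under [(i, j) |-> (-i, -j)]; a canonical sign makes
   the lists of relations comparable by [perm_eq]. *)
Definition normalize_sign (ij : int * int) : int * int :=
  let: (i, j) := ij in
  if ((i < 0) || (i == 0) && (j < 0))%R then ((- i)%R, (- j)%R) else ij.

(* The displacements of the walks through a 2-arc with steps [t1], [t2] that come
   back to it exactly when [i + j k = 0]. *)
Definition closing (l : nat) (x : bool) (t1 t2 : step) : seq (int * int) :=
  [seq normalize_sign (displacement x (t2 :: w)).2 | w <- words t2 l.-1
     & (last t2 w == t1) && ((displacement x (t2 :: w)).1 == x)].

(** * Closed walks in the double cover and the relations [i + j k = 0] *)

Section Cover.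
Variables (N k : nat).
Hypotheses (hk1 : 1 <= k) (hkn : 2 * k < N.+2).
Local Open Scope ring_scope.

Local Notation V := (bool * 'I_N.+2)%type.
Local Notation W := (V * bool)%type.
Local Notation D := (dcover (gp_rel N.+2 k)).

Definition jump (x : bool) : 'I_N.+2 := if x then k%:R else 1.

Definition mv (t : step) (w : W) : W :=
  let: ((x, i), c) := w in
  (match t with
   | None => (~~ x, i)
   | Some b => (x, if b then i + jump x else i - jump x)
   end, ~~ c).

Lemma mvK t : cancel (mv t) (mv (inv_step t)).
Proof.
by move=> [[x i] c]; case: t => [[]|] /=; rewrite ?negbK ?addrK ?subrK.
Qed.

Lemma add_jump (i j : 'I_N.+2) x :
  ((i + (if x then k else 1))%N %% N.+2 == j)%N = (j == i + jump x).
Proof.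
rewrite -val_eqE /= eq_sym /jump; case: x; last by rewrite modnDmr.
by rewrite Zp_nat /= modnDmr.
Qed.

Lemma D_mv w w' : D w w' = (w' \in [seq mv t w | t <- steps]).
Proof.
case: w w' => [[x i] c] [[y j] d].
rewrite /dcover /gp_rel !inE /= !xpair_eqE.
have -> : (c != d) = (d == ~~ c) by case: c; case: d.
case: (d == ~~ c); last by rewrite !andbF.
rewrite !andbT.
have J z (a b : 'I_N.+2) : (a == b - jump z) = (b == a + jump z).
  by rewrite eq_sym subr_eq.
case: x; case: y => //=; rewrite ?orbF ?(add_jump _ _ true) ?(add_jump _ _ false) //.
- by rewrite -(J true j i).
- by rewrite -(J false j i).
Qed.

Lemma mv_inj w : injective (mv^~ w).
Proof.
have E x : (0 < (if x then k else 1))%N && ((if x then k else 1).*2 < N.+2)%N.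
  by case: x; rewrite -?muln2; lia.
have H x (i : 'I_N.+2) : i + jump x <> i - jump x.
  move/eqP; rewrite -subr_eq0 opprB addrC addrA subrK -mulr2n.
  have -> : jump x = (if x then k else 1)%N%:R by case: x.
  rewrite -mulrnA Zp_nat -val_eqE /= muln2 modn_small; first by have := E x; lia.
  by have := E x; lia.
case: w => [[x i] c]; case=> [b|] [b'|] //= [] //.
- case: b; case: b' => // /esym; [move/esym|]; by move/H.
- by case: (x).
- by case: (x).
Qed.

Fixpoint run (w : W) (s : seq step) : W :=
  if s is t :: s' then run (mv t w) s' else w.

(** By [mv_inj] distinct steps lead to distinct neighbours, so a walk backtracks exactly when its
    word does. *)
Lemma nbw_words l t w x y :
  nbw D l (mv (inv_step t) w) w x y =
  count (fun s => (run w s == y) && (mv (inv_step (last t s)) y == x)) (words t l).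
Proof.
elim: l t w => [|l IH] t w.
  rewrite /= addn0 andbC; congr nat_of_bool.
  by case: eqP => //= ->.
rewrite wordsS count_flatten -map_comp sumnE big_map big_filter.
transitivity (\sum_(c <- [seq mv t' w | t' <- steps] | c != mv (inv_step t) w)
    nbw D l w c x y)%N.
  rewrite -[RHS]big_filter [RHS]big_uniq; last first.
    by apply: filter_uniq; rewrite map_inj_uniq //; apply: mv_inj.
  by apply: eq_bigl => c; rewrite mem_filter D_mv andbC.
rewrite big_map; apply: eq_big => [t'|t' _]; first by rewrite (inj_eq (@mv_inj w)).
by rewrite -{1}(mvK t' w) IH [RHS]/= count_map.
Qed.

Definition shift (ij : int * int) : 'I_N.+2 := ij.1%:~R + ij.2%:~R * k%:R.

Lemma run_displacement s x i c :
  run ((x, i), c) s =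
  (((displacement x s).1, i + shift (displacement x s).2), c (+) odd (size s)).
Proof.
elim: s x i c => [|[b|] s IH] x i c /=.
- by rewrite /shift /= mul0r !addr0 addbF.
- rewrite IH; case: (displacement x s) => y [p q]; rewrite /shift /=.
  congr ((_, _), _); last by case: (c); case: (odd _).
  by case: b; case: x; rewrite /= rmorphD /= ?rmorphN /=; ring.
- by rewrite IH; congr (_, _); case: (c); case: (odd _).
Qed.

Lemma shift_normalize ij : (shift (normalize_sign ij) == 0) = (shift ij == 0).
Proof.
case: ij => i j; rewrite /normalize_sign; case: ifP => // _.
by rewrite /shift /= !rmorphN /= mulNr -opprD oppr_eq0.
Qed.

(* Closed cyclically non-backtracking [l]-walks through the 2-arc [(x, y, z)]: the
   last arc coincides with the first one. *)
Definition turns (l : nat) (x y z : W) := nbw D l.-1 y z x y.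

(** As [l] is even the layer is restored, so a word that returns to its side closes up exactly when
    its shift vanishes. *)
Lemma turns_closing l t1 t2 x i c : ~~ odd l -> (0 < l)%N ->
  turns l (mv (inv_step t1) ((x, i), c)) ((x, i), c) (mv t2 ((x, i), c)) =
  count (fun ij => shift ij == 0) (closing l x t1 t2).
Proof.
move=> l_even l_gt0; set w := (x, i, c).
rewrite /turns -{1}(mvK t2 w) nbw_words /closing count_map count_filter.
apply: eq_in_count => s s_in /=.
have -> : run (mv t2 w) s = run w (t2 :: s) by [].
have -> : (mv (inv_step (last t2 s)) w == mv (inv_step t1) w) = (last t2 s == t1).
  by rewrite (inj_eq (@mv_inj w)) (inj_eq (can_inj inv_stepK)).
rewrite run_displacement /= shift_normalize (size_words s_in) -?oddS prednK // (negPf l_even) addbF.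
by rewrite !xpair_eqE eqxx andbT -{2}[i]addr0 (inj_eq (addrI i)); do 3!case: (_ == _).
Qed.

Lemma shift0 (i j : int) :
  (shift (i, j) == 0) = (N.+2%:Z %| i + j * k%:Z)%Z.
Proof.
have -> : shift (i, j) = (i + j * k%:Z)%:~R by rewrite /shift rmorphD rmorphM.
move: (i + _) => m; rewrite dvdzE /=.
case: m => m; rewrite ?NegzE ?rmorphN ?oppr_eq0 /= -pmulrn Zp_nat -val_eqE //=.
Qed.

Definition rim_turns l x :=
  count (fun ij => shift ij == 0) (closing l x (Some true) (Some true)).
Definition spoke_turns l :=
  count (fun ij => shift ij == 0) (closing l false None (Some true)).

(* The number of closed [l]-walks through a 2-arc depends only on its type, for
   all [n] and [k]: the lists of relations agree up to order. *)
Definition uniform l :=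
  all (fun x => perm_eq (closing l x (Some false) (Some false))
                        (closing l x (Some true) (Some true)) &&
    all (fun b =>
      perm_eq (closing l x None (Some b)) (closing l false None (Some true)) &&
      perm_eq (closing l x (Some b) None) (closing l false None (Some true)))
    [:: true; false]) [:: true; false].

Lemma turnsE l w t1 t2 : ~~ odd l -> (0 < l)%N -> uniform l -> t1 != t2 ->
  turns l (mv t1 w) w (mv t2 w) =
    if (t1 == None) || (t2 == None) then spoke_turns l else rim_turns l w.1.1.
Proof.
case: w => [[x i] c] l_even l_gt0 /allP/(_ x)/(_ _)/andP[].
  by case: (x).
move=> /seq.permP Urim /allP Us t12.
have {}Us b : perm_eq (closing l x None (Some b)) (closing l false None (Some true)) &&
              perm_eq (closing l x (Some b) None) (closing l false None (Some true)).
  by apply: Us; case: b.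
rewrite -{1}[t1]inv_stepK turns_closing //.
case: t1 t2 t12 => [[]|] [[]|] // _; rewrite /rim_turns /spoke_turns //=.
all: by first [rewrite Urim |
  case/andP: (Us true) => /seq.permP U1 /seq.permP U2;
  case/andP: (Us false) => /seq.permP U3 /seq.permP U4; rewrite ?U1 ?U2 ?U3 ?U4].
Qed.

(** * Automorphisms of the double cover: spokes, rims and [tau] *)

Section Automorphism.
Variable p : {perm W}.
Hypothesis pA : is_aut D p.

Lemma aut_mv t w : exists t', p (mv t w) = mv t' (p w).
Proof.
have : D (p w) (p (mv t w)) by rewrite pA D_mv; apply/mapP; exists t => //; case: (t) => [[]|].
by rewrite D_mv => /mapP[t' _ ->]; exists t'.
Qed.

(* Every spoke has an end on the side [x], where it is recognized as the edge outside
   the only 2-arc whose count differs from [spoke_turns]. *)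
Lemma spoke_preserved l x : ~~ odd l -> (0 < l)%N -> uniform l ->
  rim_turns l x != spoke_turns l -> forall w, p (mv None w) = mv None (p w).
Proof.
move=> l_even l_gt0 lU neq.
have E w : w.1.1 = x -> p (mv None w) = mv None (p w).
  move=> wx.
  have [tP EP] := aut_mv (Some true) w; have [tM EM] := aut_mv (Some false) w.
  have [tN EN] := aut_mv None w.
  have ne t t' u u' : p (mv t w) = mv u (p w) -> p (mv t' w) = mv u' (p w) ->
      t != t' -> u != u'.
    move=> Et Et'; apply: contra => /eqP uu; apply/eqP/(@mv_inj w)/(@perm_inj _ p).
    by rewrite /= Et Et' uu.
  have nPM := ne _ _ _ _ EP EM isT; have nPN := ne _ _ _ _ EP EN isT.
  have nMN := ne _ _ _ _ EM EN isT.
  have : turns l (mv (Some true) w) w (mv (Some false) w) =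
         turns l (mv tP (p w)) (p w) (mv tM (p w)) by rewrite -EP -EM /turns nbw_aut.
  rewrite !turnsE //= wx EN; move/eqP: neq nPM nPN nMN.
  by case: tP {EP} => [[]|]; case: tM {EM} => [[]|]; case: tN {EN} => [[]|].
move=> w; have [/E //|wNx] := eqVneq w.1.1 x.
have : (mv None w).1.1 = x by case: w x wNx {neq E} => [[[] ?] ?] [].
by move/E; rewrite (mvK None w) => ->; rewrite (mvK None).
Qed.

Lemma rim_line w t : t != None :> step ->  (forall v, p (mv None v) = mv None (p v)) ->
  exists2 t' : step, t' != None & forall m, p (iter m (mv t) w) = iter m (mv t') (p w).
Proof.
move=> tN pS.
have pN v t1 : t1 != None -> exists2 t', t' != None & p (mv t1 v) = mv t' (p v).
  move=> t1N; have [t' E] := aut_mv t1 v; exists t' => //; apply: contra t1N => /eqP t'0.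
  by move: E; rewrite t'0 -pS => /perm_inj/(@mv_inj v)->.
have [t' t'N E] := pN w t tN; exists t' => // m.
(* Two consecutive iterates are carried through the induction: they fix the direction of the image,
   and turning back would contradict the injectivity of [p]. *)
suff [] : p (iter m (mv t) w) = iter m (mv t') (p w) /\
          p (iter m.+1 (mv t) w) = iter m.+1 (mv t') (p w) by [].
elim: m => [//|m [IH0 IH]]; split=> //.
rewrite [LHS]/= -/(iter m.+1 (mv t) w).
have [u uN Eu] := pN (iter m.+1 (mv t) w) t tN; rewrite [LHS]Eu.
rewrite IH [RHS]/=; congr mv.
have : u != inv_step t'.
  apply/eqP => ut; move: Eu; rewrite IH ut [in RHS]iterS mvK -IH0 => /perm_inj.
  rewrite iterS -{2}(mvK t (iter m _ w)) => /(@mv_inj _); case: (t) tN => [[]|] //.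
by case: u uN {Eu} => [[]|]; case: t' t'N {E IH0 IH} => [[]|].
Qed.

Definition tau (w : W) : W := (w.1, ~~ w.2).

Lemma mv_tau t w : mv t (tau w) = tau (mv t w).
Proof. by case: w => [[x i] c]; case: t => [[]|]. Qed.

Lemma mulrn_order (i : 'I_N.+2) : i *+ N.+2 = 0.
Proof.
rewrite -mulr_natr Zp_nat (_ : inZp _ = 0) ?mulr0 //.
by apply: val_inj; rewrite /= modnn.
Qed.

Definition sgn_jump b x := if b then jump x else - jump x.

Lemma iter_mv m b x i c :
  iter m (mv (Some b)) ((x, i), c) = ((x, i + sgn_jump b x *+ m), c (+) odd m).
Proof.
elim: m => [|m IH]; first by rewrite /= addr0 addbF.
rewrite iterS IH /= -addbN mulrS /sgn_jump.
by case: b {IH}; rewrite -addrA [in LHS](addrC (_ *+ _)).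
Qed.

Lemma tau_commute_odd : odd N.+2 ->
  (forall w, p (mv None w) = mv None (p w)) -> forall w, p (tau w) = tau (p w).
Proof.
move=> n_odd pS w.
have E b v : iter N.+2 (mv (Some b)) v = tau v.
  case: v => [[x i] c]; rewrite iter_mv mulrn_order addr0 n_odd addbT //.
have [[b|//] _ Eb] := rim_line w (isT : Some true != None :> step) pS.
by rewrite -(E true) Eb E.
Qed.

Lemma natr_eqmod a b : (a%:R == b%:R :> 'I_N.+2) = (a == b %[mod N.+2])%N.
Proof. by rewrite !Zp_nat -val_eqE. Qed.

Section Even.
Hypotheses (n_even : ~~ odd N) (k_even : ~~ odd k) (n_ne4k : N.+2 <> (4 * k)%N).
Hypothesis pS : forall w, p (mv None w) = mv None (p w).

Lemma outer_to_outer : ~ (k ^ 2 = 1 %[mod (N.+2)./2])%N ->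
  ~ (k ^ 2 + 1 = 0 %[mod (N.+2)./2])%N -> forall i c, (p ((false, i), c)).1.1 = false.
Proof.
move=> km1 kp1 i c; set w := (false, i, c); apply/negP => pwV.
(* One inner step would not do: [k] is even, so [k] outer steps and the detour of length 3 end in
   different layers. Doubling makes both lengths even. *)
have E : iter (2 * k) (mv (Some true)) w =
         mv None (iter 2 (mv (Some true)) (mv None w)).
  rewrite /w iter_mv [mv None (_, _, c)]/= iter_mv /=.
  by rewrite mulnC mulrnA oddM andbF addbF addbF negbK.
have [[b|//] _ Eb] := rim_line w (isT : Some true != None :> step) pS.
have [[b'|//] _ Eb'] := rim_line (mv None w) (isT : Some true != None :> step) pS.
have := Eb (2 * k)%N; rewrite E pS Eb' pS.
case: (p w) pwV => [[[] j] d] // _.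
rewrite [mv None (true, j, d)]/= !iter_mv /=.
move/(congr1 (fun v : W => v.1.2))/addrI/esym/eqP; rewrite /sgn_jump /= => H.
have nE : N.+2 = (2 * N.+2./2)%N by rewrite mul2n -[LHS]odd_double_half /= negbK (negPf n_even).
have {H}: (k * (2 * k) == 2 %[mod N.+2])%N || (k * (2 * k) + 2 == 0 %[mod N.+2])%N.
  rewrite -!natr_eqmod natrD addr_eq0 mulrnA; apply/orP.
  case: b {Eb} H; case: b' {Eb'}; rewrite ?mulNrn ?eqr_opp; [left|right|right|left] => //.
  by rewrite -eqr_oppLR.
have -> : (k * (2 * k) = 2 * k ^ 2)%N by rewrite mulnCA mulnn.
rewrite nE.
case/orP=> /eqP.
  rewrite -[X in (_ = X %% _)%N](muln1 2) -!muln_modr => H; apply: km1.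
  by apply/eqP; rewrite -(eqn_pmul2l (isT : 0 < 2)%N) H.
rewrite -[X in (_ = X %% _)%N](muln0 2) -[X in (_ + X)%N](muln1 2).
rewrite -mulnDr -!muln_modr => H; apply: kp1.
by apply/eqP; rewrite -(eqn_pmul2l (isT : 0 < 2)%N) H.
Qed.

Lemma tau_commute_outer : (forall i c, (p ((false, i), c)).1.1 = false) ->
  forall w, p (tau w) = tau (p w).
Proof.
move=> pU.
have E i c : p (tau ((false, i), c)) = tau (p ((false, i), c)).
  set w := (false, i, c).
  have kE t : Some t != None :> step by [].
  have [[b|//] _ Eb] := rim_line w (kE true) pS.
  have [[b'|//] _ Eb'] := rim_line w (kE false) pS.
  have Ew t : tau w = mv None (mv (Some (~~ t)) (mv None (iter k (mv (Some t)) w))).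
    rewrite /w iter_mv (negPf k_even) addbF /= negbK /tau /=; congr ((_, _), _).
    by case: t; rewrite /sgn_jump /= ?mulNrn ?addrK ?subrK.
  have bb' : b != b'.
    apply/eqP => bb; have := Eb 1%N; rewrite bb -(Eb' 1%N) => /perm_inj.
    by move/(@mv_inj w (Some true) (Some false)).
  have [[u|] Eu] := aut_mv (Some (~~ true)) (mv None (iter k (mv (Some true)) w)); last first.
    by move: Eu; rewrite -pS => /perm_inj/(@mv_inj _).
  have [[u'|] Eu'] := aut_mv (Some (~~ false)) (mv None (iter k (mv (Some false)) w)); last first.
    by move: Eu'; rewrite -pS => /perm_inj/(@mv_inj _).
  have := Ew true => /(congr1 p); rewrite pS Eu pS Eb.
  have := Ew false => /(congr1 p); rewrite pS Eu' pS Eb' => ->.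
  have := pU i c; rewrite -/w; case: (p w) => [[[] j] d] // _.
  rewrite !iter_mv (negPf k_even) addbF /= negbK /tau /sgn_jump /=.
  (* The directions [b] and [b'] are opposite. If neither inner step cancels its [k] outer steps,
     the two expressions for [p (tau w)] differ by [4k]; as [2k < n], this vanishes only for
     [4k = n]. *)
  have k4 : k%:R + k%:R <> - k%:R - k%:R :> 'I_N.+2.
    move/eqP; rewrite -subr_eq0 opprD !opprK -!natrD Zp_nat -val_eqE /= => /dvdnP[q].
    move=> kq; move: hk1 hkn n_ne4k kq; case: q => [|[|q]]; nia.
  move/(congr1 (fun v : W => v.1.2)) => /= H1.
  case: u {Eu} H1; case: u' {Eu'}; case: b {Eb} bb'; case: b' {Eb'} => // _;
    rewrite ?mulNrn ?subrK ?addrK //; try by move=> ->.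
    by rewrite -!addrA => /addrI H; case: k4.
  by rewrite -!addrA => /addrI H; case: k4.
case=> [[[] i] c]; last exact: E.
have -> : (true, i, c) = mv None ((false, i), ~~ c) by rewrite /= negbK.
by rewrite -mv_tau !pS E mv_tau.
Qed.

End Even.
End Automorphism.
End Cover.

(** Commuting with the layer swap gives [p (u, x) = (s u, x + q u)]. An edge of the cover and its
    image both change layer, so [q] agrees at adjacent vertices and is constant by connectivity. *)
Lemma stable_of_tau_commute (T : finType) (e : rel T) (p : {perm T * bool}) :
  is_aut (dcover e) p -> connected e ->
  (forall w, p (w.1, ~~ w.2) = ((p w).1, ~~ (p w).2)) ->
  exists s : {perm T}, exists c : bool,
      is_aut e s /\ forall u x, p (u, x) = (s u, addb x c).
Proof.
move=> pA con ptau.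
have [T0|/card_gt0P[u0 _]] := posnP #|T|.
  exists 1%g, true; split=> [x|u]; last by have := fintype0 u.
  by have := fintype0 x.
pose q u := (p (u, false)).2; pose s u := (p (u, false)).1.
have pE u x : p (u, x) = (s u, x (+) q u).
  case: x; last by rewrite /s /q; case: (p _).
  by rewrite (ptau (u, false)) /s /q; case: (p _).
have qc u : q u = q u0.
  have /connectP[r] := con u0 u; elim/last_ind: r u => [|r v IH] u /=; first by move=> _ ->.
  rewrite rcons_path last_rcons => /andP[/IH{}IH ev] ->; rewrite -(IH _ erefl).
  have : dcover e (last u0 r, false) (v, true) by rewrite /dcover /= ev.
  by rewrite -pA !pE /dcover /= => /andP[_]; case: (q _); case: (q _).
have s_inj : injective s.
  move=> u v suv; have : p (u, false) = p (v, false) by rewrite !pE suv !qc.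
  by case/perm_inj.
exists (perm s_inj), (q u0); split=> [x y|u x]; last by rewrite pE qc permE.
have := pA (x, false) (y, true); rewrite !pE !permE /dcover /= !qc.
by case: (q u0); rewrite /= !andbT.
Qed.

(** The range suits 8-walks: [|i| + |j| <= 8] and [1 <= k < n/2] give [|i + j k| <= 8k < 4n]. *)
Lemma dvdz_lt4 (n : nat) (m : int) : (n%:Z %| m)%Z -> (- (4 * n%:Z) < m < 4 * n%:Z)%R ->
  (m = 0 \/ m = n \/ m = - n%:Z \/ m = 2 * n%:Z \/
   m = - 2 * n%:Z \/ m = 3 * n%:Z \/ m = - 3 * n%:Z)%R.
Proof.
case/dvdzP=> q -> H.
have : (-4 < q < 4)%R by nia.
move=> Hq; have : (q = 0 \/ q = 1 \/ q = -1 \/ q = 2 \/ q = -2 \/ q = 3 \/ q = -3)%R by lia.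
lia.
Qed.

(** * Solving the equations between the 8-walk counts *)

Section Arithmetic.
Variables (N k : nat).
Hypotheses (hk1 : 1 <= k) (hkn : 2 * k < N.+2).

Lemma uniform8 : uniform 8.
Proof. by vm_compute. Qed.

Lemma uniform10 : uniform 10.
Proof. by vm_compute. Qed.

Definition rel2 (i j : int) : bool := (N.+2%:Z %| (i + j * k%:Z)%R)%Z.

Lemma count_shift s :
  count (fun ij => shift N k ij == 0)%R s =
  sumn [seq (rel2 ij.1 ij.2 : nat) | ij <- s].
Proof. by elim: s => //= -[i j] s ->; rewrite shift0. Qed.

Lemma rel2P i j : rel2 i j ->
  (- (4 * N.+2%:Z) < i + j * k%:Z)%R -> (i + j * k%:Z < 4 * N.+2%:Z)%R ->
  (i + j * k%:Z = 0 \/ i + j * k%:Z = N.+2%:Z \/ i + j * k%:Z = - N.+2%:Z \/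
   i + j * k%:Z = 2 * N.+2%:Z \/ i + j * k%:Z = - 2 * N.+2%:Z \/
   i + j * k%:Z = 3 * N.+2%:Z \/ i + j * k%:Z = - 3 * N.+2%:Z)%R.
Proof. by move=> r lo hi; apply: dvdz_lt4 r _; rewrite lo hi. Qed.

Ltac rel2_lia :=
  repeat match goal with
         | H : is_true (rel2 _ _) -> _ |- _ => clear H
         | H : rel2 _ _ = false |- _ => clear H
         end;
  let H := fresh in move=> H; have := rel2P H ltac:(lia) ltac:(lia); lia.

Lemma closing8_outer : perm_eq (closing 8 false (Some true) (Some true))
  [:: (8%Z, 0%Z); (2%Z, 4%Z); (2%Z, (-4)%Z); (3%Z, 3%Z); (3%Z, 3%Z); (3%Z, (-3)%Z); (3%Z, (-3)%Z);
     (4%Z, 2%Z); (4%Z, 2%Z); (4%Z, 2%Z); (4%Z, (-2)%Z); (4%Z, (-2)%Z); (4%Z, (-2)%Z);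
     (5%Z, 1%Z); (5%Z, 1%Z); (5%Z, 1%Z); (5%Z, 1%Z);
     (5%Z, (-1)%Z); (5%Z, (-1)%Z); (5%Z, (-1)%Z); (5%Z, (-1)%Z)].
Proof. by vm_compute. Qed.

Lemma closing8_inner : perm_eq (closing 8 true (Some true) (Some true))
  [:: (0%Z, 8%Z); (4%Z, 2%Z); (4%Z, (-2)%Z); (3%Z, 3%Z); (3%Z, 3%Z); (3%Z, (-3)%Z); (3%Z, (-3)%Z);
     (2%Z, 4%Z); (2%Z, 4%Z); (2%Z, 4%Z); (2%Z, (-4)%Z); (2%Z, (-4)%Z); (2%Z, (-4)%Z);
     (1%Z, 5%Z); (1%Z, 5%Z); (1%Z, 5%Z); (1%Z, 5%Z);
     (1%Z, (-5)%Z); (1%Z, (-5)%Z); (1%Z, (-5)%Z); (1%Z, (-5)%Z)].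
Proof. by vm_compute. Qed.

(** The two entries [(0, 0)] are the 8-cycles expressing that outer and inner steps commute; they
    exist for all [n] and [k]. *)
Lemma closing8_spoke : perm_eq (closing 8 false None (Some true))
  [:: (0%Z, 0%Z); (0%Z, 0%Z); (2%Z, 0%Z); (2%Z, 0%Z);
     (0%Z, 2%Z); (0%Z, 2%Z); (2%Z, 2%Z); (2%Z, (-2)%Z);
     (1%Z, 5%Z); (1%Z, (-5)%Z); (2%Z, 4%Z); (2%Z, (-4)%Z); (3%Z, 3%Z); (3%Z, (-3)%Z);
     (4%Z, 2%Z); (4%Z, (-2)%Z); (5%Z, 1%Z); (5%Z, (-1)%Z)].
Proof. by vm_compute. Qed.

(** The constant [2] counts the entries [(0, 0)]. Relations common to both sides cancel, and
    [(2, 0)], [(0, 2)] fail because [2 <= 2k < n]. *)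
Lemma turns8_eq : rim_turns N k 8 false = spoke_turns N k 8 ->
  rim_turns N k 8 true = spoke_turns N k 8 ->
  let r i j := rel2 i j : nat in
  (r 8%Z 0%Z + (r 3%Z 3%Z + r 3%Z (-3)%Z) + 2 * (r 4%Z 2%Z + r 4%Z (-2)%Z) +
   3 * (r 5%Z 1%Z + r 5%Z (-1)%Z) =
   2 + (r 2%Z 2%Z + r 2%Z (-2)%Z) + (r 1%Z 5%Z + r 1%Z (-5)%Z) /\
  r 0%Z 8%Z + (r 3%Z 3%Z + r 3%Z (-3)%Z) + 2 * (r 2%Z 4%Z + r 2%Z (-4)%Z) +
   3 * (r 1%Z 5%Z + r 1%Z (-5)%Z) =
   2 + (r 2%Z 2%Z + r 2%Z (-2)%Z) + (r 5%Z 1%Z + r 5%Z (-1)%Z)).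
Proof.
rewrite /rim_turns /spoke_turns !(seq.permP closing8_outer) !(seq.permP closing8_inner)
  !(seq.permP closing8_spoke) !count_shift /=.
have -> : rel2 2%Z 0%Z = false by apply/negP; rel2_lia.
have -> : rel2 0%Z 2%Z = false by apply/negP; rel2_lia.
rewrite !addn0 !add0n.
do 14?[match goal with |- context [nat_of_bool (rel2 ?i ?j)] =>
  move: (nat_of_bool (rel2 i j)) => ? end].
move=> E1 E2; split; lia.
Qed.

Lemma turns8_odd : odd N -> rim_turns N k 8 false = spoke_turns N k 8 ->
  rim_turns N k 8 true = spoke_turns N k 8 ->
  (N.+2 = 5 /\ k = 2) \/ (N.+2 = 13 /\ k = 5).
Proof.
move=> n_odd E1 E2.
(* The pair [(3, 1)] is evaluated directly: the one-sided implications below do not exclude it. *)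
have [[n1 k1]|n_ne3] : (N = 1 /\ k = 1) \/ ~ (N = 1 /\ k = 1) by lia.
  by move: (turns8_eq E1 E2); rewrite /rel2 n1 k1 => -[]; vm_compute.
have [] := turns8_eq E1 E2.
have Z8 : rel2 8%Z 0%Z = false by apply/negP; rel2_lia.
have Z8' : rel2 0%Z 8%Z = false by apply/negP; rel2_lia.
have Z22 : rel2 2%Z 2%Z = false by apply/negP; rel2_lia.
have Z24' : rel2 2%Z (-4)%Z = false by apply/negP; rel2_lia.
rewrite Z8 Z8' Z22 Z24'.
have Z33 : rel2 3%Z 3%Z -> N.+2 = 3 * k + 3 \/ 2 * N.+2 = 3 * k + 3 by rel2_lia.
have Z33' : rel2 3%Z (-3)%Z -> N.+2 = 3 * k - 3 \/ k = 1 by rel2_lia.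
have Z42 : rel2 4%Z 2%Z -> N.+2 = 3 by rel2_lia.
have Z42' : rel2 4%Z (-2)%Z -> k = 2 by rel2_lia.
have Z51 : rel2 5%Z 1%Z -> N.+2 = k + 5 \/ 2 * N.+2 = k + 5 by rel2_lia.
have Z51' : rel2 5%Z (-1)%Z -> k = 5 by rel2_lia.
have Z22' : rel2 2%Z (-2)%Z -> k = 1 by rel2_lia.
have Z24 : rel2 2%Z 4%Z -> N.+2 = 2 * k + 1 by rel2_lia.
have Z15 : rel2 1%Z 5%Z -> N.+2 = 5 * k + 1 \/ 2 * N.+2 = 5 * k + 1 by rel2_lia.
have Z15' : rel2 1%Z (-5)%Z -> N.+2 = 5 * k - 1 \/ 2 * N.+2 = 5 * k - 1 by rel2_lia.
clear E1 E2; move: Z33 Z33' Z42 Z42' Z51 Z51' Z22' Z24 Z15 Z15'.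
do 10!case: (rel2 _ _); move=> Z33 Z33' Z42 Z42' Z51 Z51' Z22' Z24 Z15 Z15' E1 E2; try discriminate.
all: repeat match goal with
            | H : is_true true -> _ |- _ => specialize (H isT)
            | H : is_true false -> _ |- _ => clear H
            | H : rel2 _ _ = false |- _ => clear H
            end; clear E1 E2; lia.
Qed.

Lemma turns8_even : ~~ odd N -> ~~ odd k -> N.+2 <> 4 * k ->
  ~ k ^ 2 = 1 %[mod (N.+2)./2] -> ~ k ^ 2 + 1 = 0 %[mod (N.+2)./2] ->
  rim_turns N k 8 false = spoke_turns N k 8 ->
  rim_turns N k 8 true = spoke_turns N k 8 -> False.
Proof.
move=> n_even k_even n4k km1 kp1 E1 E2; have [] := turns8_eq E1 E2.
(* Here 5 divides [2^2 + 1] and 3 divides [2^2 - 1]; next, [k + 1] divides [k^2 - 1]. The excluded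
   congruences enter only through these cases. *)
have n26 : ~ (k = 2 /\ (N.+2 = 10 \/ N.+2 = 6)).
  by case=> k2 [] n2; [case: kp1 | case: km1]; rewrite k2 n2.
have n22 : N.+2 <> 2 * k + 2.
  move=> n2; apply: km1; have -> : (N.+2)./2 = k.+1 by lia.
  by rewrite (_ : k ^ 2 = k.-1 * k.+1 + 1) ?modnMDl //; lia.
clear km1 kp1.
have Z8 : rel2 8%Z 0%Z = false by apply/negP; rel2_lia.
have Z22 : rel2 2%Z 2%Z = false by apply/negP; rel2_lia.
have Z22' : rel2 2%Z (-2)%Z = false by apply/negP; rel2_lia.
(* Since [n] and [k] are even, a relation with [i] odd is impossible: [i + j k] is odd. *)
have Z33 : rel2 3%Z 3%Z = false by apply/negP; rel2_lia.
have Z33' : rel2 3%Z (-3)%Z = false by apply/negP; rel2_lia.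
have Z15 : rel2 1%Z 5%Z = false by apply/negP; rel2_lia.
have Z15' : rel2 1%Z (-5)%Z = false by apply/negP; rel2_lia.
have Z51 : rel2 5%Z 1%Z = false by apply/negP; rel2_lia.
have Z51' : rel2 5%Z (-1)%Z = false by apply/negP; rel2_lia.
rewrite Z8 Z22 Z22' Z33 Z33' Z15 Z15' Z51 Z51'.
(* What is left needs one of the relations [(4, 2)], [(4, -2)] and one of [(2, 4)], [(2, -4)]. Then
   [n = 2k + 4] or [k = 2], and [n = 4k + 2] or [n = 4k - 2]: either [k] is odd, or [k = 2] and [n]
   is 10 or 6. *)
have Z42 : rel2 4%Z 2%Z -> N.+2 = 2 * k + 4 by rel2_lia.
have Z42' : rel2 4%Z (-2)%Z -> k = 2 by rel2_lia.
have Z24 : rel2 2%Z 4%Z -> N.+2 = 4 * k + 2 by rel2_lia.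
have Z24' : rel2 2%Z (-4)%Z -> N.+2 = 4 * k - 2 by rel2_lia.
clear E1 E2; move: Z42 Z42' Z24 Z24'.
do 5!case: (rel2 _ _); move=> Z42 Z42' Z24 Z24' E1 E2; try discriminate.
all: repeat match goal with
            | H : is_true true -> _ |- _ => specialize (H isT)
            | H : is_true false -> _ |- _ => clear H
            | H : rel2 _ _ = false |- _ => clear H
            end; clear E1 E2; lia.
Qed.

End Arithmetic.

(** * Edge-preserving permutations, and the pairs [(5, 2)] and [(13, 5)] *)

(** The inverse of [p] is a power of [p], so it preserves edges too. *)
Lemma aut_of_hom (T : finType) (e : rel T) (p : {perm T}) :
  (forall x y, e x y -> e (p x) (p y)) -> is_aut e p.
Proof.
move=> hom x y; apply/idP/idP; last exact: hom.
have iter_hom m u v : e u v -> e ((p ^+ m)%g u) ((p ^+ m)%g v).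
  by move=> euv; elim: m => [|m IH]; rewrite ?expg0 ?perm1 // expgSr !permM hom.
move/(iter_hom #[p]%g.-1); rewrite -!permM -expgS prednK ?order_gt0 //.
by rewrite expg_order !perm1.
Qed.

Lemma aut_inv (T : finType) (e : rel T) (p : {perm T}) : is_aut e p -> is_aut e p^-1%g.
Proof. by move=> pA x y; rewrite -pA !permKV. Qed.

(* In the Desargues graph D(GP(5,2)), [tau w] is the only vertex at odd distance
   from [w] that no 3-walk reaches. *)
Lemma petersen_tau_commute (p : {perm (bool * 'I_5) * bool}) :
  is_aut (dcover (gp_rel 5 2)) p -> forall w, p (tau w) = tau (p w).
Proof.
move=> pA.
have hk1 : 1 <= 2 by []. have hkn : 2 * 2 < 3.+2 by [].
pose path3 (w w' : (bool * 'I_5) * bool) :=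
  has (fun t1 => has (fun t2 => has (fun t3 =>
    w' == @mv 3 2 t1 (mv 2 t2 (mv 2 t3 w))) steps) steps) steps.
have cases (Q : (bool * 'I_5) * bool -> bool) :
    all (fun a => all (fun c => all (fun i => Q ((a, inZp i), c)) [:: 0; 1; 2; 3; 4])
      [:: true; false]) [:: true; false] -> forall w, Q w.
  move=> H [[a i] c]; rewrite -[i]valZpK.
  have b2 b : b \in [:: true; false] by case: b.
  have i5 : val i \in [:: 0; 1; 2; 3; 4].
    by rewrite -[_ \in _]/(val i \in iota 0 5) mem_iota /= ltn_ord.
  by have /allP/(_ c (b2 c))/allP := allP H a (b2 a); apply.
have far w : ~~ path3 w (tau w).
  by move: w; apply/cases; vm_compute.
have near w w' : (w'.2 == ~~ w.2) ==> (w' != tau w) ==> path3 w w'.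
  by move: w'; apply/cases; move: w; apply/cases; vm_compute.
have par m t w : (p (iter m (@mv 3 2 t) w)).2 = odd m (+) (p w).2.
  elim: m => //= m IH; have [t' ->] := aut_mv pA t (iter m (mv 2 t) w).
  by case: (p _) IH => [[x i] c] /= ->; rewrite addNb.
have tauE (w : (bool * 'I_5) * bool) : tau w = iter 5 (mv 2 (Some true)) w.
  by apply/eqP; move: w; apply/cases; vm_compute.
(* Otherwise [near] joins [p w] to [p (tau w)] by a 3-walk, which the inverse of [p] carries to one
   from [w] to [tau w], against [far]. *)
move=> w; apply/eqP/negPn/negP => neq.
have /implyP/(_ _)/implyP/(_ neq) := near (p w) (p (tau w)).
rewrite {1}tauE par eqxx => /(_ isT)/hasP[t1 _ /hasP[t2 _ /hasP[t3 _ /eqP E]]].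
have /negP[] := far w.
have pVA := aut_inv pA.
have := congr1 p^-1%g E; rewrite permK.
have [u1 ->] := aut_mv pVA t1 (mv 2 t2 (mv 2 t3 (p w))).
have [u2 ->] := aut_mv pVA t2 (mv 2 t3 (p w)).
have [u3 ->] := aut_mv pVA t3 (p w).
have st u : u \in steps by case: u => [[]|].
rewrite permK => ->; apply/hasP; exists u1 => //; apply/hasP; exists u2 => //.
by apply/hasP; exists u3.
Qed.

Lemma turns10_13_5 : rim_turns 11 5 10 false != spoke_turns 11 5 10.
Proof. by rewrite /rim_turns /spoke_turns !count_shift; vm_compute. Qed.

(** * Basic properties of the graph, and the unstable families *)

Section Graph.
Variables (N k : nat).
Hypotheses (hk1 : 1 <= k) (hkn : 2 * k < N.+2).
Local Open Scope ring_scope.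
Local Notation V := (bool * 'I_N.+2)%type.
Local Notation e := (gp_rel N.+2 k).
Local Notation jump := (@jump N k).

Lemma gp_relE a i v : e (a, i) v =
  [|| v == (~~ a, i), v == (a, i + jump a) | v == (a, i - jump a)].
Proof.
have := D_mv k ((a, i), false) (v, true).
by rewrite /dcover /= andbT !inE /= !xpair_eqE !andbT.
Qed.

Lemma jump_neq a (i : 'I_N.+2) : i + jump a != i - jump a.
Proof.
apply/eqP => E; have := @mv_inj _ _ hk1 hkn ((a, i), false) (Some true) (Some false).
by rewrite /mv E => /(_ erefl).
Qed.

Lemma gp_connected : connected e.
Proof.
have spoke a b i : connect e (a, i) (b, i).
  have [->//|ab] := eqVneq a b; apply: connect1; rewrite gp_relE.
  by move: ab; case: a; case: b => //; rewrite eqxx.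
have rim m i : connect e (false, i) (false, i + m%:R).
  elim: m => [|m IH]; first by rewrite addr0.
  by apply: connect_trans IH _; apply: connect1; rewrite gp_relE -natr1 addrA eqxx orbT.
move=> [a i] [b j]; apply: connect_trans (spoke a false i) _.
apply: connect_trans (spoke false b j).
by have := rim (val (j - i)) i; rewrite natr_Zp addrC subrK.
Qed.

(** On the same rim the spoke neighbour determines the index. On different rims, both rim neighbours
    of one vertex would be the single spoke neighbour of the other. *)
Lemma gp_vertex_determining : vertex_determining e.
Proof.
move=> [a i] [b j] H.
have spoke := H (~~ a, i); have up := H (a, i + jump a); have dn := H (a, i - jump a).
have J := jump_neq a i; move: spoke up dn J {H}; rewrite !gp_relE !eqxx ?orbT.
case: a; case: b; rewrite /= !xpair_eqE /= ?orbF;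
  try by [move=> /esym/eqP-> | move=> _ /esym/eqP-> /esym/eqP->; rewrite eqxx].
Qed.

(** Going from [u_0] to [u_k] along the outer rim and back by two spokes and an inner edge is a
    cycle of odd length [k + 3]. *)
Lemma gp_not_bipartite : ~~ odd k -> ~ bipartite e.
Proof.
move=> k_even [f fP].
have alt m : f (false, m%:R) = f (false, 0) (+) odd m.
  elim: m => [|m IH]; first by rewrite addbF.
  have /fP : e (false, m%:R) (false, m.+1%:R) by rewrite gp_relE -natr1 eqxx orbT.
  by rewrite IH /=; case: (f _); case: (odd m); case: (f _).
have s0 : e (false, 0) (true, 0) by rewrite gp_relE eqxx.
have sk : e (false, k%:R) (true, k%:R) by rewrite gp_relE eqxx.
have r : e (true, 0) (true, k%:R) by rewrite gp_relE add0r eqxx orbT.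
move: (fP _ _ s0) (fP _ _ sk) (fP _ _ r); rewrite alt (negPf k_even) addbF.
by case: (f _); case: (f _); case: (f _).
Qed.

Lemma odd_ordD (i j : 'I_N.+2) : ~~ odd N -> odd (i + j)%R = odd i (+) odd j.
Proof. by move=> n_even; rewrite [LHS]odd_mod ?oddD //= negbK (negPf n_even). Qed.

Lemma odd_ordN (i : 'I_N.+2) : ~~ odd N -> odd (- i)%R = odd i.
Proof.
move=> n_even; have := odd_ordD i (- i) n_even; rewrite subrr /=.
by case: (odd i); case: (odd _).
Qed.

Lemma odd_natr m : ~~ odd N -> odd (m%:R : 'I_N.+2)%R = odd m.
Proof. by move=> n_even; rewrite Zp_nat [LHS]odd_mod //= negbK (negPf n_even). Qed.

Definition parity (v : V) := v.1 (+) odd v.2.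

Section HalfShift.
Variables (d : 'I_N.+2).
Hypotheses (n_even : ~~ odd N) (d_even : ~~ odd d).

Lemma parity_shift v : parity (v.1, v.2 + d) = parity v.
Proof. by rewrite /parity /= odd_ordD // (negPf d_even) addbF. Qed.

(* For [k] odd the vertices with [parity v = c] form a component of the double
   cover; for [k] even only the inner edges leave this set. *)
Definition half_shift (w : V * bool) : V * bool :=
  if parity w.1 == w.2 then ((w.1.1, w.1.2 + d), w.2) else w.

Lemma half_shift_inj : injective half_shift.
Proof.
move=> [[a i] c] [[b j] c']; rewrite /half_shift /=.
case: ifP => P; case: ifP => P' E //;
  move: (congr1 (fun w : V * bool => w.1.1) E) (congr1 (fun w : V * bool => w.1.2) E)
    (congr1 snd E) => /= Ea Ei Ec; subst b c'.
- by rewrite (addIr _ Ei).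
- by move: P'; rewrite -Ei (parity_shift (a, i)) P.
- by move: P; rewrite Ei (parity_shift (a, j)) P'.
Qed.

(** [half_shift] moves [u_0] in layer [false] and fixes it in layer [true], which no product form
    allows. *)
Lemma half_shift_unstable : d != 0 ->
  (forall t w, exists t', half_shift (mv k t w) = mv k t' (half_shift w)) ->
  unstable e.
Proof.
move=> d0 hs st; pose p := perm half_shift_inj.
have pA : is_aut (dcover e) p.
  apply: aut_of_hom => w w'; rewrite !D_mv => /mapP[t _ ->].
  have [t' E] := hs t w; rewrite !permE E; apply/mapP; exists t' => //.
  by case: (t') => [[]|].
have [s [c [_ E]]] := st p pA.
have := E (false, 0) false; have := E (false, 0) true; rewrite !permE /half_shift /parity /=.
move=> /(congr1 fst)/= <- /(congr1 (fun w : V * bool => w.1.2))/= /eqP.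
by rewrite add0r (negPf d0).
Qed.

End HalfShift.

Lemma gp_bipartite : ~~ odd N -> odd k -> bipartite e.
Proof.
move=> n_even k_odd; exists parity => -[a i] v; rewrite gp_relE /parity.
have j1 x : odd (jump x).
  by case: x => //; rewrite /jump odd_natr.
case/or3P => /eqP->; cbn [fst snd]; rewrite ?odd_ordD ?odd_ordN ?j1 //;
  by case: (a); case: (odd i).
Qed.

Lemma unstable_odd : ~~ odd N -> odd k -> unstable e.
Proof.
move=> n_even k_odd.
have j1 x : odd (jump x).
  by case: x => //; rewrite /jump odd_natr.
have two : (2%:R : 'I_N.+2) = 2 :> nat by rewrite Zp_nat /= modn_small; lia.
apply: (@half_shift_unstable 2%:R) => //; rewrite ?two //.
  by apply/eqP => E; move: two; rewrite E.
move=> t [[a i] c]; exists t; rewrite /half_shift /parity.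
case: t => [b|] /=; last first.
  by rewrite addNb eqb_negLR negbK; case: ifP.
set i' := if b then _ else _.
have -> : odd i' = ~~ odd i by rewrite /i'; case: b {i'}; rewrite odd_ordD ?odd_ordN // j1 addbT.
rewrite addbN eqb_negLR negbK; case: ifP => // _.
by rewrite /i'; case: b {i'}; rewrite /= addrAC.
Qed.

(** Take [d = 2k]. Outer edges and spokes change both parity and layer, so their ends move together.
    An inner edge has one moved end; as [2k = -2k], the shift turns its [+k] into [-k]. *)
Lemma unstable_4k : ~~ odd N -> ~~ odd k -> N.+2 = (4 * k)%N -> unstable e.
Proof.
move=> n_even k_even n4k.
have k2 : ((2 * k)%:R : 'I_N.+2) = (2 * k)%N :> nat by rewrite Zp_nat /= modn_small; lia.
have kk : (2 * k)%:R = k%:R + k%:R :> 'I_N.+2 by rewrite mul2n -addnn natrD.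
have k0 : (2 * k)%:R + (2 * k)%:R = 0 :> 'I_N.+2.
  by rewrite -natrD addnn -mul2n mulnA -n4k Zp_nat; apply: val_inj; rewrite /= modnn.
have ok : odd (k%:R : 'I_N.+2) = false.
  by rewrite odd_natr // (negPf k_even).
apply: (@half_shift_unstable (2 * k)%:R) => //; rewrite ?k2 ?oddM //.
  by apply/eqP => E; move: k2; rewrite E /=; lia.
move=> t [[a i] c]; rewrite /half_shift /parity.
case: t => [b|] /=; last first.
  by exists None; rewrite addNb eqb_negLR negbK; case: ifP.
have one : odd (1%R : 'I_N.+2) by [].
case: a => /=; last first.
  exists (Some b); set i' := if b then _ else _.
  have -> : odd i' = ~~ odd i.
    by rewrite /i'; case: b {i'}; rewrite odd_ordD ?odd_ordN // /jump one addbT.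
  rewrite eqb_negLR negbK; case: ifP => // _.
  by rewrite /i'; case: b {i'}; rewrite /= addrAC.
exists (Some (~~ b)); set i' := if b then _ else _.
have -> : odd i' = odd i by rewrite /i'; case: b {i'}; rewrite odd_ordD ?odd_ordN // /jump ok addbF.
have kN : k%:R + k%:R = - k%:R - k%:R :> 'I_N.+2.
  by apply/eqP; rewrite -subr_eq0 opprD !opprK -kk k0.
have -> : (~~ odd i == ~~ c) = ~~ (~~ odd i == c) by case: (odd i); case: (c).
have e3 : i + k%:R + (k%:R + k%:R) = i - k%:R by rewrite kN addrA addrK.
case: (~~ odd i == c) => /=; congr ((_, _), _); rewrite /i' kk /jump; case: b {i'} => /=.
- by rewrite addrA addrK.
- by rewrite kN addrA subrK.
- by rewrite e3.
- by rewrite addrA subrK.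
Qed.

Lemma odd_ordM (i j : 'I_N.+2) : ~~ odd N -> odd (i * j)%R = odd i && odd j.
Proof. by move=> n_even; rewrite [LHS]odd_mod ?oddM //= negbK (negPf n_even). Qed.

(** Multiplying indices by [k] and exchanging the rims nearly works: modulo [n], [k^2] is [1] or
    [-1] up to an error [h = n/2], which a layer-dependent correction absorbs. *)
Lemma unstable_square : ~~ odd N -> ~~ odd k ->
  (k ^ 2 = 1 %[mod N.+2./2] \/ k ^ 2 + 1 = 0 %[mod N.+2./2])%N -> unstable e.
Proof.
move=> n_even k_even kmod.
have [m nE {}kmod] : exists2 m, N.+2 = (2 * m)%N &
    (k ^ 2 = 1 %[mod m] \/ k ^ 2 + 1 = 0 %[mod m])%N.
  exists N.+2./2 => //.
  by rewrite mul2n -[LHS]odd_double_half /= negbK (negPf n_even).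
(* For even [m], the even number [k^2] could not be [1] or [-1] modulo [m]. *)
have m_odd : odd m.
  apply/negPn/negP => m_even; case: kmod => /(congr1 odd);
    by rewrite !odd_mod ?(negPf m_even) // ?oddD !oddX (negPf k_even).
pose h : 'I_N.+2 := m%:R.
have h2 : h + h = 0.
  by rewrite /h -natrD addnn -mul2n -nE Zp_nat; apply: val_inj; rewrite /= modnn.
have h0 : h != 0.
  have [m_gt0 m_lt] : (0 < m)%N /\ (m < N.+2)%N by clear kmod; lia.
  by rewrite /h Zp_nat -val_eqE /= modn_small // -lt0n.
have hN : - h = h by apply/eqP; rewrite eq_sym -addr_eq0 h2.
have hM (i : 'I_N.+2) : h * i = if odd i then h else 0.
  rewrite -{1}[i]natr_Zp mulr_natr -[in LHS](odd_double_half i) mulrnDr.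
  by rewrite -muln2 mulnC mulrnA [h *+ 2]h2 mul0rn addr0; case: (odd i).
have oh : odd h = true by rewrite /h odd_natr // m_odd.
have kh : k%:R * h = 0 by rewrite mulrC hM odd_natr // (negPf k_even).
(* The congruence holds modulo [m] by hypothesis and modulo 2 because [k^2 + m] is odd. *)
have [s kk] : exists s : bool, k%:R * k%:R + h = (if s then 1 else -1) :> 'I_N.+2.
  have mod_n a b : odd a = odd b -> a = b %[mod m] -> a = b %[mod N.+2].
    move=> ab abm; apply/eqP; rewrite nE chinese_remainder ?coprime2n //.
    by rewrite abm eqxx andbT !modn2 ab.
  case: kmod => km; [exists true | exists false]; apply/eqP.
    rewrite -natrM -natrD -[1]/(1%:R) natr_eqmod; apply/eqP/mod_n.
      by rewrite oddD oddM (negPf k_even) m_odd.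
    by rewrite modnDr mulnn.
  rewrite -subr_eq0 opprK -natrM -natrD natr1 -[0]/(0%:R) natr_eqmod; apply/eqP/mod_n.
    by rewrite /= oddD oddM (negPf k_even) m_odd.
  by rewrite -addn1 addnAC modnDr mulnn.
(* [f] exchanges the rims; [h], the element of order 2, corrects the coordinate
   exactly where the parity changes. *)
pose f (w : V * bool) : V * bool := let: ((a, i), c) := w in
  ((~~ a, i * k%:R + (if parity (a, i) (+) c then h else 0)), ~~ c).
have ff w : f (f w) = ((w.1.1, if s then w.1.2 else - w.1.2), w.2).
  case: w => [[a i] c]; rewrite /f; set g := parity (a, i) (+) c.
  have -> : parity (~~ a, i * k%:R + (if g then h else 0)) (+) ~~ c = odd i.
    rewrite /parity [_.1]/= [_.2]/= odd_ordD // odd_ordM // odd_natr // (negPf k_even) andbF.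
    have -> : odd (if g then h else 0)%R = g by case: (g); rewrite ?oh.
    by rewrite /g /parity /=; case: (a); case: (c); case: (odd i).
  have -> : (if odd i then h else 0) = h * i by rewrite hM.
  rewrite !negbK mulrDl -mulrA.
  have -> : (if g then h else 0) * k%:R = 0 by case: (g); rewrite ?mul0r // mulrC.
  rewrite addr0 [h * i]mulrC -mulrDr kk /=.
  by case: (s); rewrite ?mulr1 // mulrN1.
have f_inj : injective f.
  move=> w w' E; move: (congr1 f E); rewrite !ff.
  case: w {E} => [[a i] c]; case: w' => [[b j] c'] E.
  move: (congr1 (fun w : V * bool => w.1.1) E) (congr1 (fun w : V * bool => w.1.2) E)
    (congr1 snd E) => /= -> Ei ->; case: s {kk ff E} Ei => [->//|/oppr_inj->//].
move=> st; pose p := perm f_inj.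
have fA t w : exists t', f (mv k t w) = mv k t' (f w).
  case: w => [[a i] c]; case: t => [b|]; last first.
    exists None; rewrite /f /= /parity /=; congr ((_, _ + _), _).
    by case: (a); case: (c); case: (odd i).
  (* An outer step keeps the correction and becomes a step by [k]. An inner step toggles it and
     becomes a step by [k^2 + h], that is [1] or [-1]. *)
  case: a; last first.
    exists (Some b); rewrite /f [mv _ _ _]/=.
    have -> : parity (false, if b then i + jump false else i - jump false) (+) ~~ c =
              parity (false, i) (+) c.
      rewrite /parity [_.1]/= [_.2]/=; case: (b); rewrite odd_ordD // ?odd_ordN //.
        by rewrite /jump /=; case: (odd i); case: (c).
      by rewrite /jump /=; case: (odd i); case: (c).
    rewrite /=; congr ((_, _), _); rewrite /jump.
    by case: (b); rewrite mulrDl ?mulNr mul1r addrAC.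
  exists (Some (s == b)); rewrite /f [mv _ _ _]/=; set g := parity (true, i) (+) c.
  have -> : parity (true, if b then i + jump true else i - jump true) (+) ~~ c = ~~ g.
    rewrite /g /parity [_.1]/= [_.2]/= [(_, _).2]/=.
    by case: (b); rewrite odd_ordD // ?odd_ordN // odd_natr // (negPf k_even) addbF addbN.
  rewrite /=; congr ((_, _), _); rewrite /jump.
  have gN : (if ~~ g then h else 0) = h + (if g then h else 0).
    by case: (g); rewrite ?addr0 ?h2.
  have kE : k%:R * k%:R = (if s then 1 else -1) + h :> 'I_N.+2.
    by rewrite -kk -addrA h2 addr0.
  rewrite gN; set x := (if g then h else 0).
  have up : (i + k%:R) * k%:R + (h + x) = i * k%:R + x + (if s then 1 else -1).
    rewrite mulrDl kE; transitivity (i * k%:R + x + (if s then 1 else -1) + (h + h)); first by ring.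
    by rewrite h2 addr0.
  have dn : (i - k%:R) * k%:R + (h + x) = i * k%:R + x - (if s then 1 else -1).
    by rewrite mulrBl kE; ring.
  by case: (b); rewrite ?up ?dn; case: (s); rewrite ?opprK.
have pA : is_aut (dcover e) p.
  apply: aut_of_hom => w w'; rewrite !D_mv => /mapP[t _ ->].
  have [t' E] := fA t w; rewrite !permE E; apply/mapP; exists t' => //.
  by case: (t') => [[]|].
have [u [c [_ E]]] := st p pA.
(* The images of [u_0] in the two layers have indices that differ by [h]. *)
have := E (false, 0) false; have := E (false, 0) true; rewrite !permE /f /parity /=.
move=> /(congr1 fst)/= <- /(congr1 (fun w : V * bool => w.1.2))/= /addrI/eqP.
by rewrite eq_sym (negPf h0).
Qed.

End Graph.

(** * The stable cases and the conclusion *)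

Lemma stable_odd N k : 1 <= k -> 2 * k < N.+2 -> odd N -> stable (gp_rel N.+2 k).
Proof.
move=> hk1 hkn n_odd p pA; apply: (stable_of_tau_commute pA); first exact: gp_connected.
have commute l x : ~~ odd l -> 0 < l -> uniform l ->
    rim_turns N k l x != spoke_turns N k l -> forall w, p (tau w) = tau (p w).
  move=> le l0 lU neq; apply: (tau_commute_odd hk1 hkn pA); first by rewrite /= negbK.
  exact: (spoke_preserved hk1 hkn pA le l0 lU neq).
have [E1|/(commute 8 false isT isT uniform8)//] :=
  eqVneq (rim_turns N k 8 false) (spoke_turns N k 8).
have [E2|/(commute 8 true isT isT uniform8)//] :=
  eqVneq (rim_turns N k 8 true) (spoke_turns N k 8).
case: (turns8_odd hk1 hkn n_odd E1 E2) => -[[n_eq] k_eq].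
  by subst N k; apply: petersen_tau_commute.
by apply: (commute 10 false isT isT uniform10); rewrite n_eq k_eq turns10_13_5.
Qed.

Lemma stable_even N k : 1 <= k -> 2 * k < N.+2 -> ~~ odd N -> ~~ odd k ->
  ~ (k ^ 2 = 1 %[mod (N.+2)./2] \/ k ^ 2 + 1 = 0 %[mod (N.+2)./2] \/ N.+2 = 4 * k) ->
  stable (gp_rel N.+2 k).
Proof.
move=> hk1 hkn n_even k_even exc p pA.
apply: (stable_of_tau_commute pA); first exact: gp_connected.
have km1 : ~ k ^ 2 = 1 %[mod (N.+2)./2] by move=> E; apply: exc; left.
have kp1 : ~ k ^ 2 + 1 = 0 %[mod (N.+2)./2] by move=> E; apply: exc; right; left.
have n4k : N.+2 <> 4 * k by move=> E; apply: exc; right; right.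
have pS : forall w, p (mv k None w) = mv k None (p w).
  have [E1|neq] := eqVneq (rim_turns N k 8 false) (spoke_turns N k 8); last first.
    exact: (@spoke_preserved N k hk1 hkn p pA 8 _ isT isT uniform8 neq).
  have [E2|neq] := eqVneq (rim_turns N k 8 true) (spoke_turns N k 8); last first.
    exact: (@spoke_preserved N k hk1 hkn p pA 8 _ isT isT uniform8 neq).
  by case: (turns8_even hk1 hkn n_even k_even n4k km1 kp1 E1 E2).
apply: (tau_commute_outer hk1 hkn pA n_even k_even n4k pS).
exact: (outer_to_outer hk1 hkn pA n_even pS km1 kp1).
Qed.

Theorem theorem1p2 (n k : nat) (hk1 : 1 <= k) (hkn : 2 * k < n) :
  (odd n -> stable (gp_rel n k)) /\
  (trivially_unstable (gp_rel n k) <-> ~~ odd n /\ odd k) /\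
  (~~ odd n -> ~~ odd k ->
     (nontrivially_unstable (gp_rel n k) <->
        (k ^ 2 = 1 %[mod n./2] \/ k ^ 2 + 1 = 0 %[mod n./2] \/ n = 4 * k))).
Proof.
(* Writing [n] as [N.+2] gives the index type its ring structure. *)
case: n hkn => [|[|N]] hkn; [lia | lia |].
rewrite /= negbK -[(N./2).+1]/(N.+2)./2.
have nontrivial : ~~ odd k -> connected (gp_rel N.+2 k) /\ ~ bipartite (gp_rel N.+2 k) /\
    vertex_determining (gp_rel N.+2 k).
  move=> k_even; split; first exact: gp_connected.
  by split; [exact: gp_not_bipartite | exact: gp_vertex_determining].
split; first exact: stable_odd.
split.
  split=> [[unst triv] | [n_even k_odd]].
    have n_even : ~~ odd N by apply/negP => /(stable_odd hk1 hkn).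
    by split=> //; apply/negPn/negP => /nontrivial.
  split; first exact: unstable_odd.
  by case=> _ [[]]; apply: gp_bipartite.
move=> n_even k_even; split=> [[unst _] | exc].
  have [|km1] := eqVneq (k ^ 2 %% (N.+2)./2) (1 %% (N.+2)./2); first by left.
  have [|kp1] := eqVneq ((k ^ 2 + 1) %% (N.+2)./2) (0 %% (N.+2)./2); first by right; left.
  have [|n4k] := eqVneq N.+2 (4 * k); first by right; right.
  case: unst; apply: stable_even => //.
  by case=> [/eqP|[/eqP|/eqP]]; apply/negP.
split; last exact: nontrivial.
case: exc => [km1|[kp1|n4k]]; last exact: unstable_4k.
- by apply: unstable_square => //; left.
- by apply: unstable_square => //; right.
Qed.
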